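(* Let $\mathbf{S}$ be a skew lattice and let $x,y\in S$ be such that $y\leq x$. Then the principal skew ideal $x^{\downarrow^{*}}$ intersects every coset of $\mathcal D_x$ in $\mathcal D_y$; that is, $x^{\downarrow^{*}}\cap(\mathcal D_x\wedge z\wedge \mathcal D_x)\neq\emptyset$ for every $z\in\mathcal D_y$. Dually, the principal skew filter $y^{\uparrow^{*}}$ intersects every coset of $\mathcal D_y$ in $\mathcal D_x$; that is, $y^{\uparrow^{*}}\cap(\mathcal D_y\vee w\vee \mathcal D_y)\neq\emptyset$ for every $w\in\mathcal D_x$.
   Context: A skew lattice $\mathbf S=(S;\wedge,\vee)$ is a nonempty set $S$ with two associative binary operations satisfying $x\wedge(x\vee y)=x=(y\vee x)\wedge x$ and $x\vee(x\wedge y)=x=(y\wedge x)\vee x$ for all $x,y\in S$. The natural partial order is: $y\leq x$ iff $x\wedge y=y=y\wedge x$ (equivalently $x\vee y=x=y\vee x$). The relation $\mathcal D$ is: $x\mathrel{\mathcal D}y$ iff $x\wedge y\wedge x=x$ and $y\wedge x\wedge y=y$; it is a congruence, and $\mathcal D_x$ denotes the $\mathcal D$-class of $x$. A nonempty $I\subseteq S$ closed under $\vee$ is a skew ideal if $u\in S$, $v\in I$, $u\leq v$ imply $u\in I$; a nonempty $F\subseteq S$ closed under $\wedge$ is a skew filter if $u\in S$, $v\in F$, $u\geq v$ imply $u\in F$. The principal skew ideal $x^{\downarrow^{*}}$ is the intersection of all skew ideals containing $x$; the principal skew filter $x^{\uparrow^{*}}$ is the intersection of all skew filters containing $x$. For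 $\mathcal D$-classes $A\geq B$ (in the lattice $\mathbf S/\mathcal D$) and $b\in B$, the subset $A\wedge b\wedge A=\{a\wedge b\wedge a: a\in A\}$ of $B$ is a coset of $A$ in $B$; for $a\in A$, the subset $B\vee a\vee B=\{b\vee a\vee b: b\in B\}$ of $A$ is a coset of $B$ in $A$. *)

(* Defs.v *)
From mathcomp Require Import all_boot.
From mathcomp Require Import classical_sets.

Set Implicit Arguments.
Unset Strict Implicit.
Unset Printing Implicit Defensive.

Local Open Scope classical_set_scope.

Record skewLattice := SkewLattice {
  sk_carrier :> Type;
  sk_nonempty : inhabited sk_carrier;
  sk_meet : sk_carrier -> sk_carrier -> sk_carrier;
  sk_join : sk_carrier -> sk_carrier -> sk_carrier;
  sk_meetA : associative sk_meet;
  sk_joinA : associative sk_join;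
  sk_meetKUl : forall x y, sk_meet x (sk_join x y) = x;
  sk_meetKUr : forall x y, sk_meet (sk_join y x) x = x;
  sk_joinKIl : forall x y, sk_join x (sk_meet x y) = x;
  sk_joinKIr : forall x y, sk_join (sk_meet y x) x = x
}.

Declare Scope skew_scope.
Notation "x /^\ y" := (sk_meet x y) (at level 40, left associativity) : skew_scope.
Notation "x \v/ y" := (sk_join x y) (at level 50, left associativity) : skew_scope.
Local Open Scope skew_scope.

Section SkewLatticeDefs.
Variable S : skewLattice.
Implicit Types (x y u v a b : S) (A B I F : set S).

Definition sk_le y x : Prop := x /^\ y = y /\ y = y /^\ x.

Definition sk_D x y : Prop := x /^\ y /^\ x = x /\ y /^\ x /^\ y = y.

Definition D_class x : set S := [set y | sk_D x y].

Definition skew_ideal I : Prop :=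
  [/\ I !=set0,
      forall u v, I u -> I v -> I (u \v/ v)
    & forall u v, I v -> sk_le u v -> I u].

Definition skew_filter F : Prop :=
  [/\ F !=set0,
      forall u v, F u -> F v -> F (u /^\ v)
    & forall u v, F v -> sk_le v u -> F u].

Definition principal_skew_ideal x : set S :=
  \bigcap_(I in [set I | skew_ideal I /\ I x]) I.

Definition principal_skew_filter x : set S :=
  \bigcap_(F in [set F | skew_filter F /\ F x]) F.

(* Only meant for D-classes A >= B and b in B: the coset of A in B through b. *)
Definition meet_coset A b : set S := [set a /^\ b /^\ a | a in A].

(* Only meant for D-classes A >= B and a in A: the coset of B in A through a. *)
Definition join_coset B a : set S := [set b \v/ a \v/ b | b in B].

End SkewLatticeDefs.

(* Main.v *)
(* The element x /^\ z /^\ x of the coset of D_x through z is already below x;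
   dually, y \v/ w \v/ y is already above y. *)
Require Import Defs.
From mathcomp Require Import all_boot.
From mathcomp Require Import classical_sets.

Local Open Scope classical_set_scope.
Local Open Scope skew_scope.

(** Skew ideals are closed downwards, so each one containing [x] contains [x /^\ z /^\ x]; this lies
    in the coset because [x] itself may serve as the representative of its D-class. Filters behave
    dually. *)

Lemma skew_meetxx (S : skewLattice) (x : S) : x /^\ x = x.
(* Absorption twice: the right factor [x] is expanded to [x \v/ (x /^\ x)]. *)
Proof. by rewrite -{2}(sk_joinKIl x x) sk_meetKUl. Qed.

Lemma sk_D_refl (S : skewLattice) (x : S) : sk_D x x.
Proof. by split; rewrite !skew_meetxx. Qed.

Lemma sk_le_meet_conj (S : skewLattice) (x z : S) : sk_le (x /^\ z /^\ x) x.
Proof. by split; [rewrite !sk_meetA | rewrite -(sk_meetA _ x x)]; rewrite skew_meetxx. Qed.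

(** As [sk_le] is phrased with meets, absorption replaces idempotency here: one law for each
    bracketing of the join. *)
Lemma sk_le_join_conj (S : skewLattice) (y w : S) : sk_le y (y \v/ w \v/ y).
Proof. by split; rewrite ?sk_meetKUr // -sk_joinA sk_meetKUl. Qed.

Local Close Scope skew_scope.

Theorem proposition6p6 (S : skewLattice) (x y : S) (hyx : sk_le y x) :
  (forall z : S, D_class y z ->
     (principal_skew_ideal x `&` meet_coset (D_class x) z) !=set0) /\
  (forall w : S, D_class x w ->
     (principal_skew_filter y `&` join_coset (D_class y) w) !=set0).
Proof.
split=> [z _ | w _].
- exists (sk_meet (sk_meet x z) x); split; last by exists x; first exact: sk_D_refl.
  by move=> I [[_ _ down] Ix]; apply: down Ix (sk_le_meet_conj _ _ _).
- exists (sk_join (sk_join y w) y); split; last by exists y; first exact: sk_D_refl.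
  by move=> F [[_ _ up] Fy]; apply: up Fy (sk_le_join_conj _ _ _).
Qed.
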